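(* Let $X$ be a real Banach space and $1<p<\infty$. If $h^p(\Delta;X)$ has the Kadec–Klee property with respect to the topology $\beta$, then $X$ is midpoint locally uniformly convex.
   Context: $\Delta$ is the open unit disk in $\mathbb{C}$. A function $f:\Delta\to X$ is harmonic if it is twice continuously differentiable with zero Laplacian. $h^p(\Delta;X)$ is the space of harmonic $f:\Delta\to X$ with $\|f\|_p=\sup_{0\le r<1}(\frac{1}{2\pi}\int_0^{2\pi}\|f(re^{i\theta})\|^p\,d\theta)^{1/p}<\infty$. $\beta$ is the topology of norm uniform convergence on compact subsets of $\Delta$: $f_n\to f$ in $\beta$ iff $\sup_{z\in K}\|f_n(z)-f(z)\|\to0$ for every compact $K\subset\Delta$. A normed space $Y$ has the Kadec–Klee property with respect to a topology $\tau$ if whenever $x_n,x\in Y$ with $\|x_n\|=\|x\|=1$ for all $n$ and $x_n\to x$ in $\tau$, then $\|x_n-x\|\to0$. $X$ is midpoint locally uniformly convex if for every $x$ in the unit sphere and every $\epsilon>0$ there is $\delta>0$ with $\inf\{\max\{\|x+y\|,\|x-y\|\}:\|y\|\ge\epsilon\}\ge1+\delta$. *)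

(* Defs.v *)
From HB Require Import structures.
From mathcomp Require Import all_boot all_order all_algebra.
From mathcomp Require Import all_classical all_reals all_analysis.
Set Implicit Arguments. Unset Strict Implicit. Unset Printing Implicit Defensive.
Import Order.TTheory GRing.Theory Num.Theory.
Import numFieldNormedType.Exports.
Local Open Scope classical_set_scope.
Local Open Scope ring_scope.

Section Hardy.
Variables (R : realType) (X : normedModType R).

Definition unit_disk : set (R * R) := [set z | z.1 ^+ 2 + z.2 ^+ 2 < 1].

Definition dx (f : R * R -> X) : R * R -> X :=
  fun z => derive1 (fun t => f (t, z.2)) z.1.
Definition dy (f : R * R -> X) : R * R -> X :=
  fun z => derive1 (fun t => f (z.1, t)) z.2.

Definition partials_exist (f : R * R -> X) : Prop :=
  forall z, unit_disk z ->
    derivable (fun t => f (t, z.2)) z.1 1 /\ derivable (fun t => f (z.1, t)) z.2 1.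

Definition harmonic (f : R * R -> X) : Prop :=
  (partials_exist f /\ partials_exist (dx f) /\ partials_exist (dy f)) /\
  ({in unit_disk, continuous f} /\
   {in unit_disk, continuous (dx f)} /\ {in unit_disk, continuous (dy f)} /\
   {in unit_disk, continuous (dx (dx f))} /\ {in unit_disk, continuous (dy (dx f))} /\
   {in unit_disk, continuous (dx (dy f))} /\ {in unit_disk, continuous (dy (dy f))}) /\
  (forall z, unit_disk z -> dx (dx f) z + dy (dy f) z = 0).

Definition mean_p (p : R) (f : R * R -> X) (r : R) : R :=
  (2 * pi)^-1 * Rintegral lebesgue_measure `[0, 2 * pi]
                   (fun t => `| f (r * cos t, r * sin t) | `^ p).

Definition mean_p_set (p : R) (f : R * R -> X) : set R :=
  [set mean_p p f r | r in `[0, 1[].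

Definition in_hp (p : R) (f : R * R -> X) : Prop :=
  harmonic f /\ has_ubound (mean_p_set p f).

(* ||f||_p = sup_{0 <= r < 1} (mean_p p f r)^(1/p)
            = (sup_{0 <= r < 1} mean_p p f r)^(1/p) *)
Definition hp_norm (p : R) (f : R * R -> X) : R :=
  (sup (mean_p_set p f)) `^ p^-1.

Definition beta_cvg (F : nat -> R * R -> X) (f : R * R -> X) : Prop :=
  forall K : set (R * R), compact K -> K `<=` unit_disk ->
    (fun n => sup [set `| F n z - f z | | z in K]) @ \oo --> (0 : R).

Definition hp_kadec_klee_beta (p : R) : Prop :=
  forall (F : nat -> R * R -> X) (f : R * R -> X),
    (forall n, in_hp p (F n)) -> in_hp p f ->
    (forall n, hp_norm p (F n) = 1) -> hp_norm p f = 1 ->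
    beta_cvg F f ->
    (fun n => hp_norm p (F n \- f)) @ \oo --> (0 : R).

Definition midpoint_LUR : Prop :=
  forall x : X, `|x| = 1 -> forall eps : R, 0 < eps ->
    exists2 delta : R, 0 < delta &
      1 + delta <= inf [set Num.max `|x + y| `|x - y| | y in [set y : X | eps <= `|y|]].

End Hardy.

(* Main.v *)
(* If X is not midpoint locally uniformly convex at the unit vector x, there are
   y_n with |y_n| >= eps and max(|x + y_n|, |x - y_n|) <= 1 + 1/(n+1).  The
   harmonic functions f_n(z) = x + Re(z^(n+1)) y_n take values in the segments
   [x - y_n, x + y_n], and f_n(0) = x, so 1 <= ||f_n||_p <= 1 + 1/(n+1).  The
   normalizations f_n / ||f_n||_p converge to the constant x uniformly on compact
   subsets of the disk, but not in norm: near the unit circle Re(z^(n+1)) y_n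
   keeps a mean bounded below in terms of eps. *)
Require Import Defs.
From HB Require Import structures.
From mathcomp Require Import all_boot all_order all_algebra.
From mathcomp Require Import all_classical all_reals all_analysis.
From mathcomp Require Import measurable_realfun ring lra.
Import Order.TTheory GRing.Theory Num.Theory.
Import numFieldNormedType.Exports.
Local Open Scope ring_scope.

(** * Powers of [z] in real coordinates: derivatives, modulus, polar form *)

Lemma is_derive_scalel (R : realType) (X : normedModType R) (a : R -> R) (x d : R) (v : X) :
  is_derive x (1 : R) a d -> is_derive x (1 : R) (fun t => a t *: v) (d *: v).
Proof.
move=> [da <-].
have h : (h^-1 *: (((fun t => a t *: v) \o shift x) (h *: (1 : R)) - a x *: v)
    @[h --> 0^'] --> 'D_1 a x *: v)%classic.
  under eq_fun => h do rewrite /= -scalerBl scalerA.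
  by apply: cvgZr_tmp.
apply: DeriveDef; first by apply/cvg_ex; exists ('D_1 a x *: v).
exact: cvg_lim h.
Qed.

(* Real and imaginary parts of [z ^ n], for [z] encoded as a pair. *)
Fixpoint cpow {R : realType} (n : nat) (z : R * R) : R * R :=
  if n is m.+1 then (z.1 * (cpow m z).1 - z.2 * (cpow m z).2,
                     z.1 * (cpow m z).2 + z.2 * (cpow m z).1)
  else (1, 0).

(** At [n = 0] the factor [n] hides the truncation in [n.-1], so the derivative formulas can use
    [n.-1] in every degree. *)
Lemma cpow_mul_pred (R : realType) n (z : R * R) :
  n%:R * (cpow n z).1 =
    n%:R * (z.1 * (cpow n.-1 z).1 - z.2 * (cpow n.-1 z).2) /\
  n%:R * (cpow n z).2 =
    n%:R * (z.1 * (cpow n.-1 z).2 + z.2 * (cpow n.-1 z).1).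
Proof. by case: n => [|n] //=; rewrite !mul0r. Qed.

(** Product rule on [z * z^n] with [dz/dx = 1]: these are the two parts of [n z^(n-1)]. *)
Lemma cpow_derive_fst (R : realType) n (x y : R) :
  is_derive x (1 : R) (fun t => (cpow n (t, y)).1) (n%:R * (cpow n.-1 (x, y)).1) /\
  is_derive x (1 : R) (fun t => (cpow n (t, y)).2) (n%:R * (cpow n.-1 (x, y)).2).
Proof.
elim: n => [|n [IH1 IH2]] /=.
  by rewrite !mul0r; split; apply: is_derive_cst.
have /= [E1 E2] := cpow_mul_pred _ n (x, y).
split.
- apply: is_derive_eq.
  rewrite /GRing.scale /=.
  by rewrite -natr1 (mulrDl _ _ (cpow n _).1) E1; ring.
- apply: is_derive_eq.
  rewrite /GRing.scale /=.
  by rewrite -natr1 (mulrDl _ _ (cpow n _).2) E2; ring.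
Qed.

(** Here [dz/dy = i], so the derivative is [i n z^(n-1)]; the factor [i] swaps the two parts and
    negates one. *)
Lemma cpow_derive_snd (R : realType) n (x y : R) :
  is_derive y (1 : R) (fun t => (cpow n (x, t)).1) (- (n%:R * (cpow n.-1 (x, y)).2)) /\
  is_derive y (1 : R) (fun t => (cpow n (x, t)).2) (n%:R * (cpow n.-1 (x, y)).1).
Proof.
elim: n => [|n [IH1 IH2]] /=.
  by rewrite !mul0r oppr0; split; apply: is_derive_cst.
have /= [E1 E2] := cpow_mul_pred _ n (x, y).
split.
- apply: is_derive_eq.
  rewrite /GRing.scale /=.
  by rewrite -natr1 (mulrDl _ _ (cpow n _).2) E2; ring.
- apply: is_derive_eq.
  rewrite /GRing.scale /=.
  by rewrite -natr1 (mulrDl _ _ (cpow n _).1) E1; ring.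
Qed.

Lemma cpow_continuous (R : realType) n :
  continuous (fun z : R * R => (cpow n z).1) /\
  continuous (fun z : R * R => (cpow n z).2).
Proof.
elim: n => [|n [IH1 IH2]] /=; first by split=> z; apply: cvg_cst.
split=> z; [apply: cvgB|apply: cvgD]; apply: cvgM;
  (exact: cvg_fst || exact: cvg_snd || exact: IH1 || exact: IH2).
Qed.

Lemma cpow_normsq (R : realType) n (z : R * R) :
  (cpow n z).1 ^+ 2 + (cpow n z).2 ^+ 2 = (z.1 ^+ 2 + z.2 ^+ 2) ^+ n.
Proof.
elim: n => [|n IH] /=; first by rewrite expr0; ring.
by rewrite [RHS]exprS -IH; ring.
Qed.

(** De Moivre's formula, by the angle addition formulas. *)
Lemma cpow_polar (R : realType) n (r t : R) :
  cpow n (r * cos t, r * sin t) = (r ^+ n * cos (n%:R * t), r ^+ n * sin (n%:R * t)).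
Proof.
elim: n => [|n IH] /=; first by rewrite mul0r cos0 sin0 expr0 mul1r mulr0.
rewrite IH /= -natr1 mulrDl mul1r cosD sinD exprS; congr pair; ring.
Qed.

(* [c + Re (z ^ n) v + Im (z ^ n) w]; the family is closed under both partial
   derivatives, so harmonicity is a computation on the coefficients. *)
Definition harm_poly {R : realType} {X : normedModType R} n (c v w : X) (z : R * R) : X :=
  c + (cpow n z).1 *: v + (cpow n z).2 *: w.

(** * Partial derivatives and harmonicity of the polynomial family *)

Section harm_poly.
Variables (R : realType) (X : normedModType R).
Implicit Types (c v w : X).

Lemma harm_poly_derive_fst n c v w (x y : R) :
  is_derive x (1 : R) (fun t => harm_poly n c v w (t, y))
   (harm_poly n.-1 0 (n%:R *: v) (n%:R *: w) (x, y)).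
Proof.
have [D1 D2] := cpow_derive_fst _ n x y.
have := is_derive_scalel _ _ _ _ _ v D1; have := is_derive_scalel _ _ _ _ _ w D2 => D1' D2'.
apply: is_derive_eq; rewrite /harm_poly !scalerA ![_%:R * _]mulrC //.
Qed.

(** The factor [i] in the derivative of [z^n] turns the coefficient pair [(v, w)] into [(w, -v)]. *)
Lemma harm_poly_derive_snd n c v w (x y : R) :
  is_derive y (1 : R) (fun t => harm_poly n c v w (x, t))
   (harm_poly n.-1 0 (n%:R *: w) (- (n%:R *: v)) (x, y)).
Proof.
have [D1 D2] := cpow_derive_snd _ n x y.
have := is_derive_scalel _ _ _ _ _ v D1; have := is_derive_scalel _ _ _ _ _ w D2 => D1' D2'.
apply: is_derive_eq; rewrite /harm_poly scalerN !scalerA ![_%:R * _]mulrC scaleNr.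
by rewrite -!addrA; congr (_ + _); rewrite addrC.
Qed.

Lemma dx_harm_poly n c v w :
  dx (harm_poly n c v w) = harm_poly n.-1 0 (n%:R *: v) (n%:R *: w).
Proof.
apply/funext => -[x y]; rewrite /dx derive1E /=.
by have D := harm_poly_derive_fst n c v w x y; rewrite derive_val.
Qed.

Lemma dy_harm_poly n c v w :
  dy (harm_poly n c v w) = harm_poly n.-1 0 (n%:R *: w) (- (n%:R *: v)).
Proof.
apply/funext => -[x y]; rewrite /dy derive1E /=.
by have D := harm_poly_derive_snd n c v w x y; rewrite derive_val.
Qed.

Lemma harm_poly_partials n c v w : partials_exist (harm_poly n c v w).
Proof.
move=> [x y] _; split=> /=.
  by have [] := harm_poly_derive_fst n c v w x y.
by have [] := harm_poly_derive_snd n c v w x y.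
Qed.

Lemma harm_poly_continuous n c v w : continuous (harm_poly n c v w).
Proof.
have [C1 C2] := cpow_continuous R n.
move=> z; apply: cvgD; [apply: cvgD; [exact: cvg_cst|]|]; apply: cvgZr_tmp; [exact: C1|exact: C2].
Qed.

Lemma harm_poly_harmonic n c v w : Defs.harmonic (harm_poly n c v w).
Proof.
split; [|split].
- by split; [|split]; rewrite ?dx_harm_poly ?dy_harm_poly; apply: harm_poly_partials.
- by rewrite !(dx_harm_poly, dy_harm_poly); do !split; move=> z _; apply: harm_poly_continuous.
(* Two uses of [dy] yield the same coefficients as two uses of [dx], with opposite signs. *)
- move=> z _; rewrite !(dx_harm_poly, dy_harm_poly) /harm_poly !scalerN !add0r !scalerA.
  by rewrite addrACA !subrr addr0.
Qed.
End harm_poly.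

(** * Means over circles centred at the origin *)

Section circle_means.
Variables (R : realType) (X : normedModType R).
Implicit Types (f g : R * R -> X) (p r M : R).
Local Notation mu := (@lebesgue_measure R).
Local Notation circle := (`[0, 2 * pi]%classic : set R).

Lemma measurable_circle : measurable circle.
Proof. exact: measurable_itv. Qed.

Lemma lebesgue_measure_circle : mu circle = (2 * pi)%:E.
Proof.
rewrite lebesgue_measure_itv /= lte_fin mulr_gt0 ?pi_gt0//.
by rewrite -EFinB subr0.
Qed.

Lemma bounded_integrable_circle (g : R -> R) M :
  measurable_fun setT g -> (forall t, `|g t| <= M) -> mu.-integrable circle (EFin \o g).
Proof.
move=> mg gM; apply: measurable_bounded_integrable.
- exact: measurable_circle.
- by rewrite /= lebesgue_measure_circle ltry.
- exact: measurable_funTS.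
- exists M; split; first exact: num_real.
  by move=> x Mx t _ /=; apply: le_trans (gM t) (ltW Mx).
Qed.

Lemma circle_pow_integrable p f r M : 0 <= p -> continuous f ->
  (forall t, `|f (r * cos t, r * sin t)| <= M) ->
  mu.-integrable circle (EFin \o (fun t => `|f (r * cos t, r * sin t)| `^ p)).
Proof.
move=> p0 cf fM; have M0 : 0 <= M by apply: le_trans (fM 0).
apply: (@bounded_integrable_circle _ (M `^ p)).
- apply: (measurableT_comp (measurable_powR p)).
  apply: continuous_measurable_fun => t.
  apply: cvg_norm.
  apply: (@continuous_comp _ _ _ (fun t => (r * cos t, r * sin t)) f); last exact: cf.
  by apply: (@cvg_pair _ _ _ _ (nbhs (r * cos t)) (nbhs (r * sin t)));
    apply: cvgM; try exact: cvg_cst; [exact: continuous_cos|exact: continuous_sin].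
- move=> t; rewrite ger0_norm ?powR_ge0//.
  by apply: ge0_ler_powR; rewrite ?nnegrE.
Qed.

Lemma mean_p_le p f r M : 0 <= p -> continuous f ->
  (forall t, `|f (r * cos t, r * sin t)| <= M) -> mean_p p f r <= M `^ p.
Proof.
move=> p0 cf fM; have M0 : 0 <= M by apply: le_trans (fM 0).
have pi0 := pi_gt0 R.
rewrite /mean_p mulrC ler_pdivrMr ?mulr_gt0//.
have -> : M `^ p * (2 * pi) = Rintegral mu circle (fun=> M `^ p).
  by rewrite Rintegral_cst /= ?lebesgue_measure_circle.
apply: le_Rintegral.
- exact: measurable_circle.
- exact: circle_pow_integrable p0 cf fM.
- by apply: (@bounded_integrable_circle _ `|M `^ p|).
- by move=> t _; apply: ge0_ler_powR; rewrite ?nnegrE.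
Qed.

Lemma mean_p_eq p f r M :
  (forall t, `|f (r * cos t, r * sin t)| = M) -> mean_p p f r = M `^ p.
Proof.
move=> fM; rewrite /mean_p; under [X in Rintegral _ _ X]eq_fun => t do rewrite fM.
rewrite Rintegral_cst /= ?lebesgue_measure_circle//=.
by rewrite mulrC mulfK// mulf_neq0// gt_eqF// pi_gt0.
Qed.

Lemma mean_p0 p f : mean_p p f 0 = `|f (0, 0)| `^ p.
Proof. by apply: mean_p_eq => t; rewrite !mul0r. Qed.

Lemma mean_pZ p f r M (a : R) : 0 <= p -> continuous f ->
  (forall t, `|f (r * cos t, r * sin t)| <= M) ->
  mean_p p (fun z => a *: f z) r = `|a| `^ p * mean_p p f r.
Proof.
move=> p0 cf fM; rewrite /mean_p.
under [X in Rintegral _ _ X]eq_fun => t do rewrite normrZ powRM//.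
rewrite RintegralZl ?measurable_circle//; last exact: circle_pow_integrable p0 cf fM.
by rewrite mulrCA.
Qed.

Lemma sin_natM2pi n : sin (n%:R * (2 * pi)) = 0 :> R.
Proof.
by have := periodicn (@sinD2pi R) n 0; rewrite add0r sin0 -[pi *+ 2]mulr_natl -[_ *+ n]mulr_natl.
Qed.

(** Over whole periods [cos ^ 2] has mean one half; the successor keeps the frequency nonzero. *)
Lemma Rintegral_cos2 n (u v : R) :
  Rintegral mu circle (fun t => u * cos (n.+1%:R * t) ^+ 2 + v) = pi * (u + 2 * v).
Proof.
(* Antiderivative from [cos^2 s = (1 + cos (2 s)) / 2], with the sine of the double angle
   expanded. *)
pose G := fun t : R => u * (2^-1 * t +
  (2 * n.+1%:R)^-1 * (sin (n.+1%:R * t) * cos (n.+1%:R * t))) + v * t.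
have n0 : n.+1%:R != 0 :> R by rewrite pnatr_eq0.
have DG (t : R) : is_derive t (1:R) G (u * cos (n.+1%:R * t) ^+ 2 + v).
  have D0 : is_derive t (1 : R) (fun t : R => n.+1%:R * t) n.+1%:R.
    by apply: is_derive_eq; rewrite /GRing.scale /= mulr1.
  have D1 : is_derive t (1 : R) (fun t : R => sin (n.+1%:R * t)) (n.+1%:R * cos (n.+1%:R * t)).
    by apply: is_derive_eq (is_derive1_comp _ _) _; rewrite mulrC.
  have D2 : is_derive t (1 : R) (fun t : R => cos (n.+1%:R * t)) (- (n.+1%:R * sin (n.+1%:R * t))).
    by apply: is_derive_eq (is_derive1_comp _ _) _; rewrite mulrC mulrN.
  apply: is_derive_eq; rewrite /GRing.scale /=.
  have -> : cos (n.+1%:R * t) ^+ 2 = 2^-1 * (1 + cos (n.+1%:R * t) ^+ 2 - sin (n.+1%:R * t) ^+ 2).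
    by rewrite sin2cos2; field.
  by field; rewrite -?nat1r in n0 *; rewrite n0.
have cG : continuous G.
  by move=> t; apply: differentiable_continuous; apply/derivable1_diffP; have [] := DG t.
rewrite /Rintegral (@continuous_FTC2 _ _ G).
- by rewrite -EFinB /G /= sin_natM2pi !mulr0 sin0 !(mul0r, mulr0, addr0, subr0); field.
- by rewrite mulr_gt0 ?pi_gt0.
- apply: continuous_subspaceT => t.
  apply: cvgD; last exact: cvg_cst.
  apply: cvgM; first exact: cvg_cst.
  rewrite /=; under eq_fun do rewrite expr2.
  have C : {for t, continuous (fun t : R => cos (n.+1%:R * t))}.
    apply: continuous_comp; last exact: continuous_cos.
    by apply: cvgM; [exact: cvg_cst|exact: cvg_id].
  exact: (cvgM C C).
- split.
  + by move=> t _; have [] := DG t.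
  + by apply: cvg_at_right_filter; exact: cG.
  + by apply: cvg_at_left_filter; exact: cG.
- by move=> t _; rewrite derive1E; have D := DG t; rewrite derive_val.
Qed.

(* A crude substitute for the tangent-line inequality: it reduces lower bounds on
   the [p]-th mean to an integral of [cos ^ 2]. *)
Lemma powR_ge_affine p (s m : R) : 1 <= p -> 0 <= s -> 0 < m ->
  m `^ (p - 1) * (s - m) <= s `^ p.
Proof.
move=> p1 s0 m0; have [sm|ms] := leP s m.
  apply: le_trans (powR_ge0 _ _).
  by rewrite mulr_ge0_le0 ?powR_ge0// subr_le0.
rewrite -(@mulr_powRB1 _ s p)//; last by lra.
rewrite mulrC; apply: ler_pM; rewrite ?powR_ge0//; try lra.
by apply: ge0_ler_powR; rewrite ?nnegrE; lra.
Qed.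

(** Insert the lower bound on the norm into [powR_ge_affine] and integrate; the mean of [cos ^ 2]
    produces [u / 2]. *)
Lemma mean_p_ge p f r M n (u v m : R) : 1 <= p -> 0 < m -> continuous f ->
  (forall t, `|f (r * cos t, r * sin t)| <= M) ->
  (forall t, u * cos (n.+1%:R * t) ^+ 2 - v <= `|f (r * cos t, r * sin t)|) ->
  m `^ (p - 1) * (u / 2 - v - m) <= mean_p p f r.
Proof.
move=> p1 m0 cf fM fuv; have pi0 := pi_gt0 R.
rewrite /mean_p [leRHS]mulrC ler_pdivlMr ?mulr_gt0//.
set A := m `^ (p - 1).
have -> : A * (u / 2 - v - m) * (2 * pi) =
    Rintegral mu circle (fun t => (A * u) * cos (n.+1%:R * t) ^+ 2 + A * (- v - m)).
  by rewrite Rintegral_cos2; field.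
apply: le_Rintegral.
- exact: measurable_circle.
- apply: (@bounded_integrable_circle _ (`|A * u| + `|A * (- v - m)|)).
    apply: measurable_funD => //; apply: measurable_funM => //.
    apply: measurable_funX; apply: continuous_measurable_fun => t.
    apply: continuous_comp; last exact: continuous_cos.
    by apply: cvgM; [exact: cvg_cst|exact: cvg_id].
  move=> t; apply: le_trans (ler_normD _ _) _; rewrite lerD2r normrM.
  rewrite ler_piMr// normrX expr_le1//.
  by rewrite ler_norml cos_geN1 cos_le1.
- by apply: circle_pow_integrable cf fM; lra.
- move=> t _; apply: le_trans (powR_ge_affine _ _ _ p1 (normr_ge0 _) m0).
  rewrite -/A; have := fuv t; rewrite -subr_ge0 => h.
  rewrite -subr_ge0.
  have -> : A * (`|f (r * cos t, r * sin t)| - m) -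
      (A * u * cos (n.+1%:R * t) ^+ 2 + A * (- v - m)) =
    A * (`|f (r * cos t, r * sin t)| - (u * cos (n.+1%:R * t) ^+ 2 - v)) by ring.
  by rewrite mulr_ge0// powR_ge0.
Qed.

(** * Norms in [h^p]: normalization and lower bounds *)

Lemma hp_norm_cst p (x : X) : `|x| = 1 -> hp_norm p (fun=> x) = 1.
Proof.
move=> x1; rewrite /hp_norm.
have -> : mean_p_set p (fun=> x) = [set 1]%classic.
  apply/seteqP; split=> [_ [r _ <-]|_ ->] /=.
    by rewrite (@mean_p_eq p _ r 1)// powR1.
  by exists 0; rewrite ?mean_p0 ?x1 ?powR1 //= in_itv /= lexx ltr01.
by rewrite sup1 powR1.
Qed.

(** The supremum [S] of the means lies between [|f(0)|^p], the mean at radius zero, and [M^p]. The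
    normalizing factor [S^(-1/p)] is therefore controlled on both sides. *)
Lemma hp_norm_normalize p f M : 1 < p -> continuous f -> 0 < `|f (0, 0)| ->
  (forall r t, 0 <= r < 1 -> `|f (r * cos t, r * sin t)| <= M) ->
  exists2 a : R, M^-1 <= a <= `|f (0, 0)|^-1 & hp_norm p (fun z => a *: f z) = 1.
Proof.
move=> p1 cf f0 fM.
have p0 : 0 <= p by lra.
have M0 : 0 < M.
  by apply: lt_le_trans f0 _; have := fM 0 0; rewrite !mul0r; apply; rewrite lexx ltr01.
set E := mean_p_set p f.
have ubE : ubound E (M `^ p).
  by move=> _ [r /= rI <-]; apply: mean_p_le => // t; apply: fM; rewrite in_itv in rI.
have E0 : E (`|f (0, 0)| `^ p).
  by exists 0; rewrite ?mean_p0//= in_itv /= lexx ltr01.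
have E1 : (E !=set0)%classic by eexists; exact: E0.
have hubE : has_ubound E by exists (M `^ p).
set S := sup E.
have S_ge : `|f (0, 0)| `^ p <= S by exact: ub_le_sup.
have S_le : S <= M `^ p by exact: ge_sup.
have S0 : 0 < S by apply: lt_le_trans S_ge; exact: powR_gt0.
have pp : p * p^-1 = 1 by rewrite mulfV// gt_eqF//; lra.
have ip : 0 <= p^-1 by rewrite invr_ge0.
exists (S `^ p^-1)^-1.
  apply/andP; split.
    rewrite lef_pV2 ?posrE ?powR_gt0//.
    rewrite -[leRHS](powRr1 (ltW M0)) -pp powRrM.
    by apply: ge0_ler_powR; rewrite ?nnegrE ?powR_ge0// ltW.
  rewrite lef_pV2 ?posrE ?powR_gt0//.
  rewrite -[leLHS](powRr1 (ltW f0)) -pp powRrM.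
  by apply: ge0_ler_powR; rewrite ?nnegrE ?powR_ge0// ltW.
(* Scaling by this factor divides every [p]-th mean by exactly [S]. *)
have aE : `|(S `^ p^-1)^-1| `^ p = S^-1.
  rewrite ger0_norm ?invr_ge0 ?powR_ge0//.
  by rewrite -powRN -powRrM mulNr mulrC pp powR_inv1// ltW.
rewrite /hp_norm.
set E' := mean_p_set _ _.
have E'E r : 0 <= r < 1 -> mean_p p (fun z => (S `^ p^-1)^-1 *: f z) r = S^-1 * mean_p p f r.
  by move=> r01; rewrite (@mean_pZ _ _ _ M)// ?aE// => t; exact: fM.
have ubE' : ubound E' 1.
  move=> _ [r /= rI <-]; rewrite in_itv /= in rI; rewrite E'E// mulrC ler_pdivrMr// mul1r.
  by apply: ub_le_sup => //; exists r.
suff -> : sup E' = 1 by rewrite powR1.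
apply/eqP; rewrite eq_le; apply/andP; split.
  apply: ge_sup => //; exists (mean_p p (fun z => (S `^ p^-1)^-1 *: f z) 0).
  by exists 0 => //; rewrite /= in_itv /= lexx ltr01.
(* After multiplication by [S] the goal is [sup E <= S * sup E'], which is checked radius by
   radius. *)
rewrite -(@ler_pM2l _ S)// mulr1; apply: ge_sup => // _ [r /= rI <-].
have rI' := rI; rewrite in_itv /= in rI'.
rewrite -(ler_pdivrMl _ _ S0) -(E'E r rI').
by apply: ub_le_sup; [exists 1|exists r].
Qed.

Lemma in_hp_bounded p f M : 0 <= p -> Defs.harmonic f -> continuous f ->
  (forall r t, 0 <= r < 1 -> `|f (r * cos t, r * sin t)| <= M) ->
  in_hp p f.
Proof.
move=> p0 hf cf fM; split => //; exists (M `^ p) => _ [r /= rI <-].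
by apply: mean_p_le => // t; apply: fM; rewrite in_itv in rI.
Qed.

(** One radius suffices. Membership in [h^p] makes the set of means bounded, so that [sup] is a true
    supremum and not a default value. *)
Lemma hp_norm_ge p f r (m : R) : 0 < p -> in_hp p f -> 0 <= r < 1 -> 0 <= m ->
  m `^ p <= mean_p p f r -> m <= hp_norm p f.
Proof.
move=> p0 [_ hub] rI m0 mE; rewrite /hp_norm.
have pp : p * p^-1 = 1 by rewrite mulfV// gt_eqF.
rewrite -[leLHS](powRr1 m0) -pp powRrM.
have h : mean_p p f r <= sup (mean_p_set p f).
  by apply: ub_le_sup => //; exists r => //=; rewrite in_itv.
apply: ge0_ler_powR; rewrite ?nnegrE ?invr_ge0 ?powR_ge0 ?(ltW p0)//.
  by apply: le_trans h; apply: le_trans mE; rewrite powR_ge0.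
exact: le_trans h.
Qed.

End circle_means.

(** * Upper and lower estimates for [x + Re(z^n) y] *)

Section harm_poly_bounds.
Variables (R : realType) (X : normedModType R).
Implicit Types (x y : X).

(** [x + s y] is the convex combination of [x + y] and [x - y] with weights [(1 + s) / 2] and
    [(1 - s) / 2]. *)
Lemma norm_segment_le x y (s : R) : `|s| <= 1 ->
  `|x + s *: y| <= Num.max `|x + y| `|x - y|.
Proof.
move=> s1; set M := Num.max _ _.
have -> : x + s *: y = ((1 + s) / 2) *: (x + y) + ((1 - s) / 2) *: (x - y).
  rewrite !scalerDr !scalerN addrACA -scalerDl -scalerBl.
  have -> : (1 + s) / 2 + (1 - s) / 2 = 1 by field.
  have -> : (1 + s) / 2 - (1 - s) / 2 = s by field.
  by rewrite scale1r.
move: s1; rewrite ler_norml => /andP[s1 s2].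
apply: le_trans (ler_normD _ _) _; rewrite (normrZ _ (x + y)) (normrZ _ (x - y)).
have s3 : 0 <= (1 + s) / 2 by lra.
have s4 : 0 <= (1 - s) / 2 by lra.
rewrite (ger0_norm s3) (ger0_norm s4).
have h1 : `|x + y| <= M by rewrite le_max lexx.
have h2 : `|x - y| <= M by rewrite le_max lexx orbT.
nra.
Qed.

Lemma harm_poly_circle n x y (r t : R) :
  harm_poly n x y 0 (r * cos t, r * sin t) = x + (r ^+ n * cos (n%:R * t)) *: y.
Proof. by rewrite /harm_poly cpow_polar scaler0 addr0. Qed.

Lemma harm_poly_circle_le n x y (r t : R) : 0 <= r < 1 ->
  `|harm_poly n x y 0 (r * cos t, r * sin t)| <= Num.max `|x + y| `|x - y|.
Proof.
move=> /andP[r0 r1]; rewrite harm_poly_circle; apply: norm_segment_le.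
rewrite normrM normrX mulr_ile1 ?exprn_ge0//.
  by rewrite exprn_ile1// ger0_norm// ltW.
by rewrite ler_norml cos_geN1 cos_le1.
Qed.

Lemma harm_poly_in_hp (p : R) n x y : 0 <= p -> in_hp p (harm_poly n x y 0).
Proof.
move=> p0; apply: (@in_hp_bounded _ _ _ _ (Num.max `|x + y| `|x - y|)) => //.
- exact: harm_poly_harmonic.
- exact: harm_poly_continuous.
- by move=> r t; apply: harm_poly_circle_le.
Qed.

Lemma harm_polyZ n x y (a : R) z :
  harm_poly n (a *: x) (a *: y) 0 z = a *: harm_poly n x y 0 z.
Proof. by rewrite /harm_poly !scaler0 !addr0 scalerDr !scalerA mulrC. Qed.

(** The continuous function [|z|^2] attains its maximum on [K], below 1; [s] is the square root of
    that maximum, and [|Re z^n| <= |z|^n <= s^n]. *)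
Lemma cpow_compact_le (K : set (R * R)) : compact K -> (K `<=` @unit_disk R)%classic ->
  exists2 s : R, 0 <= s < 1 & forall n z, K z -> `|(cpow n z).1| <= s ^+ n.
Proof.
move=> cK Kd; have [->|K0] := eqVneq K set0.
  by exists 0; rewrite ?lexx ?ltr01.
have cg : {within K, continuous (fun z : R * R => z.1 ^+ 2 + z.2 ^+ 2)}%classic.
  apply: continuous_subspaceT => z.
  by under eq_fun do rewrite !expr2; apply: cvgD; apply: cvgM; (exact: cvg_fst || exact: cvg_snd).
have [c cIK cmax] := compact_EVT_max ((set0P _).1 K0) cK cg.
have c1 : c.1 ^+ 2 + c.2 ^+ 2 < 1 by apply: Kd; rewrite inE in cIK.
have c0 : 0 <= c.1 ^+ 2 + c.2 ^+ 2 by rewrite addr_ge0 ?sqr_ge0.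
exists (Num.sqrt (c.1 ^+ 2 + c.2 ^+ 2)).
  by rewrite sqrtr_ge0/= -sqrtr1 ltr_sqrt.
move=> n z Kz.
rewrite -(@ler_pXn2r _ 2)// ?nnegrE ?exprn_ge0 ?sqrtr_ge0//.
rewrite real_normK ?num_real// exprAC sqr_sqrtr//.
apply: (@le_trans _ _ ((z.1 ^+ 2 + z.2 ^+ 2) ^+ n)).
  by rewrite -cpow_normsq lerDl sqr_ge0.
by apply: lerXn2r; rewrite ?nnegrE// ?addr_ge0 ?sqr_ge0// cmax// inE.
Qed.


(** On a suitable circle the oscillation along [y] dominates the constant [x], with a bound that
    does not depend on the degree. *)
Lemma hp_norm_oscillation_ge (p m : R) n x y : 1 < p -> 0 < m ->
  `|x| <= m -> 16 * m <= `|y| -> m <= hp_norm p (harm_poly n.+1 x y 0).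
Proof.
move=> p1 m0 xm ym.
(* At this radius the oscillating term has amplitude [`|y| / 2] for every [n]. *)
pose r : R := (1 / 2) `^ n.+1%:R^-1.
have rn : r ^+ n.+1 = 1 / 2.
  rewrite -powR_mulrn ?powR_ge0// -powRrM mulVf ?pnatr_eq0// powRr1//; lra.
have r01 : 0 <= r < 1.
  rewrite powR_ge0/=; rewrite ltNge; apply/negP => r1.
  have := exprn_ege1 n.+1 r1; rewrite rn; lra.
apply: (@hp_norm_ge _ _ _ _ r) => //; [lra|by apply: harm_poly_in_hp; lra|exact: ltW|].
(* Prepares [mean_p_ge] with [u = 8 m] and [v = 2 m], for which [u / 2 - v - m = m]. The value of
   [u] is half of the 16 in the hypothesis. *)
have -> : m `^ p = m `^ (p - 1) * (8 * m / 2 - m * 2 - m).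
  rewrite -(@mulr_powRB1 _ m p) ?(ltW m0)//; last by lra.
  by field.
apply: (@mean_p_ge _ _ _ _ _ (Num.max `|x + y| `|x - y|) n) => //.
- by lra.
- exact: harm_poly_continuous.
- by move=> t; apply: harm_poly_circle_le.
- move=> t; rewrite harm_poly_circle rn.
  set c := cos _.
  have c1 : `|c| <= 1 by rewrite ler_norml cos_geN1 cos_le1.
  have h : `|(1 / 2 * c) *: y| - `|x| <= `|x + (1 / 2 * c) *: y|.
    by rewrite [x + _]addrC; apply: lerB_normD.
  apply: le_trans h; rewrite normrZ normrM ger0_norm; last by lra.
  have -> : c ^+ 2 = `|c| ^+ 2 by rewrite real_normK ?num_real.
  (* [k1] gives [|c| |y| >= 16 m |c|] and [k2] gives [m |c| >= m c^2], which trades the linear bound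
     for the quadratic one. *)
  have k1 : 0 <= `|c| * (`|y| - 16 * m) by rewrite mulr_ge0// subr_ge0.
  have k2 : 0 <= m * (`|c| * (1 - `|c|)) by rewrite !mulr_ge0 ?subr_ge0// ltW.
  nra.
Qed.

End harm_poly_bounds.

(** * Contradiction from the normalized oscillating sequence *)

Theorem theorem3p4 (R : realType) (X : completeNormedModType R) (p : R) :
  1 < p -> hp_kadec_klee_beta X p -> midpoint_LUR X.
Proof.
move=> p1 KK x x1 eps eps0; apply: contrapT => nodelta.
have Y n : exists y : X, eps <= `|y| /\ Num.max `|x + y| `|x - y| < 1 + n.+1%:R^-1.
  apply: contrapT => noy; apply: nodelta; exists n.+1%:R^-1; first by rewrite invr_gt0.
  apply: lb_le_inf.
    (* The infimum must range over a nonempty set; [eps x] has norm exactly [eps]. *)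
    exists (Num.max `|x + eps *: x| `|x - eps *: x|), (eps *: x) => //=.
    by rewrite normrZ x1 mulr1 ger0_norm// ltW.
  move=> _ [y /= ey <-]; rewrite leNgt; apply/negP => xy.
  by apply: noy; exists y.
have [y yP] := choice Y => {Y nodelta}.
have ye n : eps <= `|y n| by have [] := yP n.
have ymax n : Num.max `|x + y n| `|x - y n| <= 1 + n.+1%:R^-1 by have [_ /ltW] := yP n.
have p0 : 0 <= p by lra.
have f0 n : harm_poly n.+1 x (y n) 0 (0, 0) = x.
  by rewrite /harm_poly /= !mul0r subr0 addr0 !scale0r !addr0.
(* The value at the origin is the unit vector [x], whence [a <= 1]; the segment bound gives the
   other side. *)
have A n : exists a : R, (1 + n.+1%:R^-1)^-1 <= a <= 1 /\
    hp_norm p (fun z => a *: harm_poly n.+1 x (y n) 0 z) = 1.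
  have [||a aI aE] := @hp_norm_normalize _ _ p _ (1 + n.+1%:R^-1) p1
    (@harm_poly_continuous _ _ n.+1 x (y n) 0).
  - by rewrite f0 x1.
  - by move=> r t r01; apply: le_trans (harm_poly_circle_le _ _ _ _ _ _ t r01) (ymax n).
  by exists a; split=> //; rewrite f0 x1 invr1 in aI.
have [a aP] := choice A => {A}.
have d01 n : 0 < (n.+1%:R^-1 : R) <= 1.
  by rewrite invr_gt0 ltr0Sn invf_le1 ?ltr0Sn// ler1n.
(* With [d = 1/(n+1)], [1 - d <= 1/(1 + d)] forces [a n] to tend to 1, and [d <= 1] gives the
   uniform bound [1/2]. *)
have aI n : 1 - n.+1%:R^-1 <= a n /\ 2^-1 <= a n /\ a n <= 1.
  have [/andP[a1 a2] _] := aP n; have /andP[d0 d1] := d01 n.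
  move: a1 d0 d1; set d := n.+1%:R^-1 => a1 d0 d1; split; [|split] => //.
    apply: le_trans a1; rewrite -[leRHS]mul1r ler_pdivlMr; nra.
  apply: le_trans a1; rewrite lef_pV2 ?posrE; lra.
pose F n : R * R -> X := harm_poly n.+1 (a n *: x) (a n *: y n) 0.
(* The constant [x], written in degree 0 so that the lemmas on [harm_poly] apply. *)
pose f : R * R -> X := harm_poly 0 x 0 0.
have fE : f = fun=> x by apply/funext => z; rewrite /f /harm_poly !scaler0 !addr0.
(* The difference is again in the family: a vanishing constant plus an oscillation of amplitude
   bounded below. *)
have FfE n : F n \- f = harm_poly n.+1 ((a n - 1) *: x) (a n *: y n) 0.
  apply/funext => z; rewrite /= fE /F /harm_poly !scaler0 !addr0.
  by rewrite (scalerBl (a n) 1 x) scale1r addrAC.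
have aa n : `|(a n - 1) *: x| <= n.+1%:R^-1.
  rewrite normrZ x1 mulr1 ler_norml.
  move: (aI n) (d01 n); move: n.+1%:R^-1 => d [? [? ?]] /andP[? ?].
  by apply/andP; split; lra.
have F_f : ((fun n => hp_norm p (F n \- f)) @ \oo --> (0 : R))%classic.
  apply: KK.
  - by move=> n; apply: harm_poly_in_hp.
  - exact: harm_poly_in_hp.
  - move=> n; have [_ <-] := aP n; congr hp_norm; apply/funext => z; exact: harm_polyZ.
  - by rewrite fE hp_norm_cst.
  move=> K cK Kd; have [s /andP[s0 s1] sK] := cpow_compact_le _ _ cK Kd.
  (* The constant part is at most [1/(n+1)], and [|a n| |y n| <= 2] bounds the oscillating part by
     [2 s^(n+1) <= 2 s^n]. *)
  have ub n : ubound [set `|F n z - f z| | z in K]%classic (n.+1%:R^-1 + 2 * s ^+ n).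
    move=> _ [z Kz <-]; have -> : F n z - f z = (F n \- f) z by [].
    rewrite FfE /harm_poly scaler0 addr0.
    apply: le_trans (ler_normD _ _) _; apply: lerD (aa n) _.
    rewrite !normrZ mulrC; apply: ler_pM; rewrite ?mulr_ge0//.
      have y2 : 2 * `|y n| <= 4.
        have -> : 2 * `|y n| = `|(x + y n) - (x - y n)|.
          by rewrite opprB addrC addrA subrK -mulr2n normrMn mulr_natl.
        apply: le_trans (ler_normB _ _) _.
        move: (ymax n) (d01 n); rewrite ge_max; move: n.+1%:R^-1 => d /andP[? ?] /andP[? ?]; lra.
      have [? [? ?]] := aI n; rewrite ger0_norm; [have := normr_ge0 (y n); nra|lra].
    apply: le_trans (sK n.+1 z Kz) _.
    by rewrite exprS ler_piMl ?exprn_ge0// ltW.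
  apply: (@squeeze_cvgr _ _ _ _ (fun=> 0) (fun n => n.+1%:R^-1 + 2 * s ^+ n)).
  - apply: nearW => n; apply/andP; split.
      (* For empty [K] the supremum takes its default value 0. *)
      have [->|/set0P[z Kz]] := eqVneq K set0; first by rewrite image_set0 sup0.
      apply: le_trans (normr_ge0 (F n z - f z)) _.
      by apply: ub_le_sup; [eexists; exact: ub|exists z].
    have [->|/set0P[z Kz]] := eqVneq K set0.
      by rewrite image_set0 sup0 addr_ge0 ?invr_ge0 ?mulr_ge0 ?exprn_ge0.
    by apply: ge_sup; [exists `|F n z - f z|, z|exact: ub].
  - exact: cvg_cst.
  - rewrite -[X in (_ --> X)%classic]addr0; apply: cvgD; first exact: cvg_harmonic.
    by apply: cvg_geometric; rewrite ger0_norm.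
(* Since [a n >= 1/2], the amplitude [|a n y n|] is at least [eps / 2 = 16 m], as the oscillation
   bound requires. *)
pose m := eps / 32.
have m0 : 0 < m by rewrite divr_gt0.
have near1 : (\forall n \near \oo, hp_norm p (F n \- f) < m)%classic by exact: cvgr_lt F_f _ m0.
have near2 : (\forall n \near \oo, n.+1%:R^-1 < m :> R)%classic by exact: cvgr_lt cvg_harmonic _ m0.
have [n [n1 n2]] := filter_ex (filterI near1 near2).
have : m <= hp_norm p (F n \- f).
  rewrite FfE; apply: hp_norm_oscillation_ge => //; first exact: le_trans (aa n) (ltW n2).
  have [? [? ?]] := aI n; rewrite normrZ ger0_norm; last by lra.
  have := ye n; rewrite /m; nra.
by rewrite leNgt n1.
Qed.
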